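(* Let $G$ be a finite nontrivial abelian group and let $S$ be a sequence over $G$. (i) If $|S|\ge\log_2|G|+1$ and $G$ is not an elementary abelian $2$-group, then $S$ contains a proper, nonempty $\{\pm1\}$-weighted zero-sum subsequence. (ii) If $|S|\ge\log_2|G|+2$ and $G$ is not an elementary abelian $2$-group of even rank, then $S$ contains a proper, nonempty $\{\pm1\}$-weighted zero-sum subsequence of even length. (iii) If $|S|>\log_2|G|$, then $S$ contains a nonempty $\{\pm1\}$-weighted zero-sum subsequence, and if $|S|>\log_2|G|+1$, then such a subsequence may be found with even length.
   Context: A sequence over $G$ is a finite (unordered) list of elements of $G$, repetitions allowed; $|S|$ is its length (number of terms). A subsequence is a sublist; it is proper if it is not all of $S$. A sequence $g_1,\ldots,g_n$ is a $\{\pm1\}$-weighted zero-sum sequence if there exist $\varepsilon_1,\ldots,\varepsilon_n\in\{1,-1\}$ with $\sum_{i=1}^n\varepsilon_ig_i=0$. An elementary abelian $2$-group is one isomorphic to $\mathbb Z_2^k$ for some $k$, and its rank is $k$. *)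

(* Defs.v *)
From HB Require Import structures.
From mathcomp Require Import all_boot all_order all_algebra all_fingroup.
From mathcomp Require Import reals exp.

Set Implicit Arguments.
Unset Strict Implicit.
Unset Printing Implicit Defensive.

Import GRing.Theory.
Local Open Scope ring_scope.

Definition log2 {R : realType} (x : R) : R := ln x / ln 2.

Definition pm_zero_sum (G : zmodType) (T : seq G) : Prop :=
  exists2 eps : 'I_(size T) -> int,
    (forall i, eps i = 1 \/ eps i = -1) &
    \sum_(i < size T) T`_i *~ eps i = 0.

(* The row-vector type with k entries is the additive group Z_2^k (trivial for
   k = 0), and \isog is isomorphism of the underlying additive groups. *)
Definition elem_abelian2 (G : finZmodType) (k : nat) : Prop :=
  [set: G] \isog [set: 'rV['Z_2]_k].

(* Main.v *)
(** Subset sums collide by pigeonhole, and two index sets [I <> J] with the same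
    sum yield a weighted zero-sum subsequence supported on their symmetric
    difference, which has even length if [I] and [J] have the same parity; this
    gives (iii). In the extremal cases (i) and (ii), suppose that no proper
    subsequence works. Then the index sets avoiding a fixed [k] (of a given
    parity, for (ii)) and those containing [k] are both in bijection with [G]
    through their sums, so [I] has the same sum as some [J] on the other side;
    the symmetric difference must be everything, so [J] is the complement of
    [I]. Taking [I] empty and [I] a singleton gives [2 g_i = 0] for every term,
    hence [G] is an elementary abelian 2-group. In (ii), moreover, [|S|] is even
    because it is the cardinality of the complement of the empty set, and
    [|G| = 2 ^ (|S| - 2)]. *)

Require Import Defs.
From HB Require Import structures.
From mathcomp Require Import all_boot all_order all_algebra all_fingroup.
From mathcomp Require Import pgroup abelian.
From mathcomp Require Import reals exp.

Set Implicit Arguments.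
Unset Strict Implicit.
Unset Printing Implicit Defensive.

Import Order.TTheory GRing.Theory Num.Theory.
Local Open Scope ring_scope.

Definition symdiff (I : finType) (A B : {set I}) : {set I} :=
  (A :\: B) :|: (B :\: A).

Lemma symdiff_eq0 (I : finType) (A B : {set I}) :
  (symdiff A B == set0) = (A == B).
Proof. by rewrite setU_eq0 !setD_eq0 eqEsubset. Qed.

Lemma symdiff_eqT (I : finType) (A B : {set I}) :
  symdiff A B = setT -> B = ~: A.
Proof.
move=> /setP AB; apply/setP=> i; have := AB i.
by rewrite !inE; case: (i \in A); case: (i \in B).
Qed.

Lemma setD_setD0 (I : finType) (A B : {set I}) :
  (A :\: B) :&: (B :\: A) = set0.
Proof. by apply/setP=> i; rewrite !inE; case: (i \in A); case: (i \in B). Qed.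

Lemma odd_symdiff (I : finType) (A B : {set I}) :
  odd #|symdiff A B| = odd #|A| (+) odd #|B|.
Proof.
rewrite cardsU setD_setD0 cards0 subn0 -(cardsID B A) -(cardsID A B).
rewrite [B :&: A]setIC !oddD.
by case: (odd #|A :\: B|); case: (odd #|B :\: A|); case: (odd #|A :&: B|).
Qed.

Lemma pm_zero_sum_map (G : zmodType) (I : eqType) (f : I -> G) (e : I -> int)
    (s : seq I) :
  (forall i, e i = 1 \/ e i = -1) -> \sum_(i <- s) f i *~ e i = 0 ->
  pm_zero_sum [seq f i | i <- s].
Proof.
case: s => [|x0 s] he hs; first by exists (fun=> 1); [left | rewrite big_ord0].
exists (fun j => e (nth x0 (x0 :: s) j)) => [j //|].
rewrite -[RHS]hs [RHS](big_nth x0) -(size_map f) big_mkord.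
apply: eq_bigr => j _; congr (_ *~ _); rewrite (nth_map x0) //.
by rewrite -(size_map f).
Qed.

Definition ssum (G : zmodType) (S : seq G) (I : {set 'I_(size S)}) : G :=
  \sum_(i in I) S`_i.
Arguments ssum {G} S I.

Lemma ssumC (G : zmodType) (S : seq G) (I : {set 'I_(size S)}) :
  ssum S (~: I) = ssum S setT - ssum S I.
Proof.
apply/eqP; rewrite eq_sym subr_eq addrC /ssum (big_setID I) /=.
by rewrite setTI setTD.
Qed.

(** Terms indexed by [I :&: J] cancel from the two equal sums. What remains is a relation with sign
    [1] on [I :\: J] and [-1] on [J :\: I]. *)
Lemma symdiff_pm_zero_sum (G : zmodType) (S : seq G)
    (I J : {set 'I_(size S)}) : ssum S I = ssum S J ->
  exists T : seq G,
    [/\ subseq T S, size T = #|symdiff I J| & pm_zero_sum T].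
Proof.
move=> eqIJ; exists [seq S`_(val i) | i <- enum (symdiff I J)]; split.
(* Writing [S] as the image of all its indices turns selection of terms into filtering of the index
   list. *)
- have eqS : [seq S`_(val i) | i <- enum 'I_(size S)] = S.
    by rewrite (map_comp (nth 0 S) val) val_enum_ord map_nth_iota0 ?take_size.
  rewrite -[X in subseq _ X]eqS.
  by apply: map_subseq; rewrite [enum (mem 'I__)]enumT; apply: filter_subseq.
- by rewrite size_map -cardE.
apply: (@pm_zero_sum_map _ _ _ (fun i => if i \in I then 1 else -1)).
  by move=> i; case: ifP; [left | right].
rewrite big_enum (eq_bigl [predU I :\: J & J :\: I]) /=; last first.
  by move=> i; rewrite inE.
rewrite bigU /=; last by rewrite -setI_eq0 setD_setD0.
rewrite (eq_bigr (fun i : 'I__ => S`_i)); last first.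
  by move=> i; rewrite inE => /andP[_ ->].
rewrite [X in _ + X](eq_bigr (fun i : 'I__ => - S`_i)); last first.
  by move=> i; rewrite inE => /andP[/negPf-> _].
rewrite sumrN; apply/eqP; rewrite subr_eq0; apply/eqP.
move: eqIJ; rewrite /ssum (big_setID J) [RHS](big_setID I) /= [J :&: I]setIC.
exact: addrI.
Qed.

Lemma pigeonhole (aT rT : finType) (f : aT -> rT) (A : {set aT}) :
  (#|rT| < #|A|)%N ->
  exists x y, [/\ x \in A, y \in A, x != y & f x = f y].
Proof.
move=> ltA; have /dinjectivePn[x xA [y]] : ~~ dinjectiveb f A.
  apply: contraL ltA => /dinjectiveP f_inj; rewrite -leqNgt.
  by rewrite -(card_in_imset f_inj) max_card.
by rewrite !inE eq_sym => /andP[neq yA] eqf; exists x, y.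
Qed.

Lemma inj_onto (aT rT : finType) (f : aT -> rT) (A : {set aT}) (y : rT) :
  {in A &, injective f} -> (#|rT| <= #|A|)%N -> exists2 x, x \in A & f x = y.
Proof.
move=> f_inj leA; have /setP/(_ y) : f @: A = setT.
  by apply/eqP; rewrite eqEcard subsetT cardsT (card_in_imset f_inj).
by rewrite inE => /imsetP[x xA ->]; exists x.
Qed.

(** Fix [l] in [A]. Each subset of [A :\ l] acquires parity [b] by adding [l] exactly when its own
    parity is wrong, and deleting [l] recovers it. *)
Lemma card_parity_powerset (I : finType) (A : {set I}) (b : bool) :
  A != set0 ->
  (2 ^ #|A|.-1 <= #|[set B in powerset A | odd #|B| == b]|)%N.
Proof.
case/set0Pn=> l lA.
pose f (B : {set I}) := if odd #|B| == b then B else l |: B.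
have lNB B : B \in powerset (A :\ l) -> l \notin B.
  by rewrite powersetE => /subsetP sBA; apply/negP=> /sBA; rewrite !inE eqxx.
rewrite (cardsD1 l A) lA -card_powerset -(@card_in_imset _ _ f); last first.
  move=> B C /lNB lB /lNB lC; rewrite /f.
  case: (odd #|B| == b); case: (odd #|C| == b) => // eqBC.
  - by rewrite eqBC setU11 in lB.
  - by rewrite -eqBC setU11 in lC.
  - by rewrite -(setU1K lB) eqBC setU1K.
apply/subset_leq_card/subsetP=> _ /imsetP[B BA ->].
have sBA : B \subset A.
  by move: BA; rewrite powersetE => /subset_trans-> //; apply: subsetDl.
rewrite !inE /f; case: ifP => [-> | hb]; first by rewrite sBA.
rewrite subUset sub1set lA sBA cardsU1 (lNB _ BA) oddD /=.
by move: hb; case: (b); case: (odd #|B|).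
Qed.

Lemma card_setU1_family (I : finType) (k : I) (P Q : pred {set I}) :
  (forall B : {set I}, k \notin B -> P B -> Q (k |: B)) ->
  (#|[set B : {set I} | P B & k \notin B]|
     <= #|[set B : {set I} | Q B & k \in B]|)%N.
Proof.
move=> PQ; rewrite -(@card_in_imset _ _ (fun B => k |: B)); last first.
  move=> B C; rewrite !inE => /andP[_ kB] /andP[_ kC] eqBC.
  by rewrite -(setU1K kB) eqBC setU1K.
apply/subset_leq_card/subsetP=> _ /imsetP[B + ->]; rewrite !inE.
by move=> /andP[PB kB]; rewrite eqxx PQ.
Qed.

Lemma card_parity_avoiding (n : nat) (k : 'I_n) (b : bool) : (1 < n)%N ->
  (2 ^ (n - 2) <= #|[set B : {set 'I_n} | odd #|B| == b & k \notin B]|)%N.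
Proof.
move=> n_gt1; have cardk : #|[set~ k]| = n.-1 by rewrite cardsC1 card_ord.
have k0 : [set~ k] != set0 by rewrite -card_gt0 cardk -subn1 subn_gt0.
rewrite subn2 -cardk (leq_trans (card_parity_powerset b k0)) //.
apply/subset_leq_card/subsetP=> B; rewrite !inE => /andP[sB ->] /=.
by rewrite -disjoints1 disjoint_sym disjoints_subset.
Qed.

(** Two sets on the same side of [k] are never complementary, so [ssum] is injective on each side,
    hence onto [G] by cardinality. The predicate [Q] is trivial for (i) and fixes the parity for
    (ii). *)
Lemma ssum_complement (G : finZmodType) (S : seq G) (k : 'I_(size S))
    (Q : pred {set 'I_(size S)}) :
  (forall I J, Q I -> Q J -> I != J -> ssum S I = ssum S J -> J = ~: I) ->
  (#|G| <= #|[set I : {set 'I_(size S)} | Q I & k \notin I]|)%N ->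
  (#|G| <= #|[set I : {set 'I_(size S)} | Q I & k \in I]|)%N ->
  [/\ forall I, Q I -> Q (~: I) /\ ssum S (~: I) = ssum S I,
      forall x : G, exists I : {set 'I_(size S)}, ssum S I = x
    & #|[set I : {set 'I_(size S)} | Q I & k \notin I]| = #|G|].
Proof.
move=> QC; set N := [set I | _ & _ \notin _]; set Y := [set I | _ & _] => leN leY.
have injN : {in N &, injective (ssum S)}.
  move=> I J; rewrite !inE => /andP[QI kI] /andP[QJ kJ] eqIJ.
  case: (eqVneq I J) => // neq; move: kJ.
  by rewrite (QC I J) // inE (negPf kI).
have injY : {in Y &, injective (ssum S)}.
  move=> I J; rewrite !inE => /andP[QI kI] /andP[QJ kJ] eqIJ.
  case: (eqVneq I J) => // neq; move: kJ.
  by rewrite (QC I J) // inE kI.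
split=> [I QI | x |].
- have [J [QJ neq eqIJ]] : exists J, [/\ Q J, I != J & ssum S I = ssum S J].
    have [kI | kI] := boolP (k \in I).
      have [J] := inj_onto (ssum S I) injN leN.
      rewrite inE => /andP[QJ kJ] eqJ; exists J; split=> //.
      by apply: contraNneq kJ => <-.
    have [J] := inj_onto (ssum S I) injY leY.
    rewrite inE => /andP[QJ kJ] eqJ; exists J; split=> //.
    by apply: contraNneq kI => ->.
  by rewrite -(QC I J).
- by have [I _ <-] := inj_onto x injN leN; exists I.
by apply/eqP; rewrite eqn_leq leN andbT -(card_in_imset injN) max_card.
Qed.

Lemma elem_abelian2_card (G : finZmodType) :
  (forall x : G, x + x = 0) -> exists2 k, #|G| = (2 ^ k)%N & elem_abelian2 G k.
Proof.
move=> xx0; have abG : (2.-abelem [set: G])%g.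
  apply/abelemP=> //; split=> [|x _]; first exact: FinRing.zmod_abelian.
  exact: xx0.
have cardG : #|G| = (2 ^ logn 2 #|G|)%N.
  by rewrite -cardsT; apply: card_pgroup (abelem_pgroup abG).
exists (logn 2 #|G|) => //; rewrite /elem_abelian2.
rewrite (isog_abelem_card _ abG) !cardsT card_mx mul1n card_ord -cardG eqxx andbT.
apply/abelemP=> //; split=> [|x _]; first exact: FinRing.zmod_abelian.
apply/matrixP=> i j; rewrite FinRing.zmodXgE !mxE.
by case: (x i j) => [[|[|]]] // ?; apply/val_inj.
Qed.

(** The first hypothesis makes the total sum zero, so the complement of [[set i]] sums to the
    opposite of the [i]-th term; the second then says that this term equals its opposite. *)
Lemma ssum_double0 (G : zmodType) (S : seq G) (I : {set 'I_(size S)}) :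
  ssum S (~: set0) = ssum S set0 ->
  (forall i, ssum S (~: [set i]) = ssum S [set i]) -> ssum S I + ssum S I = 0.
Proof.
move=> sum0 sum1; rewrite -big_split big1 // => i _.
move: sum0 (sum1 i); rewrite (ssumC [set i]) setC0 [ssum S set0]big_set0 => ->.
by rewrite /ssum big_set1 sub0r => /eqP; rewrite eq_sym -addr_eq0 => /eqP.
Qed.

(** A collision whose symmetric difference is not everything gives the subsequence. The sets [I] and
    [J] stay in the conclusion so that the parity of [size T] can be read off [Q]. *)
Lemma proper_or_complement (G : finZmodType) (S : seq G)
    (Q : pred {set 'I_(size S)}) :
  (exists I J : {set 'I_(size S)}, exists T : seq G,
     [/\ Q I, Q J & [/\ subseq T S, T <> S, T <> [::], pm_zero_sum T
                      & size T = #|symdiff I J|]]) \/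
  (forall I J, Q I -> Q J -> I != J -> ssum S I = ssum S J -> J = ~: I).
Proof.
case: (boolP [exists I, exists J, [&& Q I, Q J, I != J,
                ssum S I == ssum S J & symdiff I J != setT]]); last first.
  move=> none; right=> I J QI QJ neq eqIJ; apply: symdiff_eqT; apply/eqP.
  move: none; rewrite negb_exists => /forallP/(_ I); rewrite negb_exists.
  by move=> /forallP/(_ J); rewrite QI QJ neq eqIJ eqxx negbK.
move=> /existsP[I /existsP[J /and5P[QI QJ neq /eqP eqIJ neqT]]]; left.
have [T [subT sizeT zsT]] := symdiff_pm_zero_sum eqIJ.
exists I, J, T; split=> //; split=> // [TS | T0].
- move: neqT; rewrite -subTset; apply/negP/negPn.
  by rewrite subTset eqEcard subsetT cardsT card_ord -sizeT TS /=.
- by move: neq; rewrite -symdiff_eq0 -cards_eq0 -sizeT T0.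
Qed.

(** Multiplying by [ln 2] and exponentiating replaces the real bounds by inequalities between
    natural numbers. *)
Lemma log2_natE (R : realType) (m n c : nat) : (0 < m)%N ->
  ((log2 (m%:R : R) + c%:R <= n%:R) = (m * 2 ^ c <= 2 ^ n)%N) *
  ((log2 (m%:R : R) + c%:R < n%:R) = (m * 2 ^ c < 2 ^ n)%N).
Proof.
move=> m_gt0; have ln2 : 0 < ln (2 : R) by rewrite ln_gt0 ?ltr1n.
rewrite -(ler_pM2r ln2) -(ltr_pM2r ln2) mulrDl divfK ?gt_eqF // !mulr_natl.
rewrite -!lnXn ?ltr0n // -lnM ?posrE ?exprn_gt0 ?ltr0n //.
rewrite ler_ln ?ltr_ln ?posrE ?mulr_gt0 ?exprn_gt0 ?ltr0n //.
by rewrite -!natrX -natrM ler_nat ltr_nat.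
Qed.

Theorem theorem4p1 (R : realType) (G : finZmodType) (hG : (1 < #|G|)%N)
    (S : seq G) :
  [/\ (* (i) *)
      (size S)%:R >= log2 (#|G|%:R : R) + 1 ->
      ~ (exists k : nat, elem_abelian2 G k) ->
      exists T : seq G,
        [/\ subseq T S, T <> S, T <> [::] & pm_zero_sum T],
      (* (ii) *)
      (size S)%:R >= log2 (#|G|%:R : R) + 2 ->
      ~ (exists k : nat, elem_abelian2 G k /\ ~~ odd k) ->
      exists T : seq G,
        [/\ subseq T S, T <> S, T <> [::], pm_zero_sum T & ~~ odd (size T)]
    & (* (iii) *)
      ((size S)%:R > log2 (#|G|%:R : R) ->
       exists T : seq G, [/\ subseq T S, T <> [::] & pm_zero_sum T]) /\
      ((size S)%:R > log2 (#|G|%:R : R) + 1 ->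
       exists T : seq G,
         [/\ subseq T S, T <> [::], pm_zero_sum T & ~~ odd (size T)])].
Proof.
have G_gt0 : (0 < #|G|)%N by apply: ltnW.
(* Nontriviality of [G] makes this strict; it provides the index [k], which is 0 below, and keeps
   [size S - 2] from truncating. *)
have expG c : (#|G| * 2 ^ c.+1 <= 2 ^ size S)%N -> (c.+1 < size S)%N.
  move=> le2; rewrite -(@ltn_exp2l 2) //; apply: leq_trans le2.
  by rewrite ltn_Pmull ?expn_gt0.
split.
- rewrite -[1]/(1%:R) log2_natE // => le2 notel.
  have size2 := expG 0 le2; pose k := Ordinal (ltnW size2).
  have [[I [J [T [_ _ [subT TS T0 zsT _]]]]] | compl] :=
    @proper_or_complement G S predT; first by exists T.
  have cardN : (#|G| <= #|[set I : {set 'I_(size S)} | predT I & k \notin I]|)%N.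
    have <- : powerset [set~ k] =
        [set I : {set 'I_(size S)} | predT I & k \notin I].
      apply/setP=> I; rewrite !inE /= -disjoints1 disjoint_sym.
      by rewrite disjoints_subset.
    rewrite card_powerset cardsC1 card_ord -(leq_pmul2r (ltn0Sn 1)).
    by rewrite -expnSr (ltn_predK size2).
  have [sumC onto _] := ssum_complement compl cardN
    (leq_trans cardN (card_setU1_family (fun _ _ _ => isT))).
  case: notel; have [|d _ ?] := @elem_abelian2_card G; last by exists d.
  by move=> x; have [I <-] := onto x; apply: ssum_double0 => [|i]; apply: (sumC _ isT).2.
- rewrite -[2]/(2%:R) log2_natE // => le4 notel.
  have size3 := expG 1 le4; have size2 := ltnW size3.
  pose k := Ordinal (ltnW size2).
  have compl b := @proper_or_complement G S (fun I => odd #|I| == b).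
  have [[I [J [T [/eqP pI /eqP pJ [subT TS T0 zsT sizeT]]]]] | compl0] :=
    compl false.
    by exists T; split; rewrite ?sizeT ?odd_symdiff ?pI ?pJ.
  have [[I [J [T [/eqP pI /eqP pJ [subT TS T0 zsT sizeT]]]]] | compl1] :=
    compl true.
    by exists T; split; rewrite ?sizeT ?odd_symdiff ?pI ?pJ.
  have leG : (#|G| <= 2 ^ (size S - 2))%N.
    by rewrite -(leq_pmul2r (ltn0Sn 3)) -[4%N]/(2 ^ 2)%N -expnD subnK.
  have cardN b : (#|G| <= #|[set I : {set 'I_(size S)} |
                             odd #|I| == b & k \notin I]|)%N.
    exact: leq_trans leG (card_parity_avoiding k b size2).
  have cardY b : (#|G| <= #|[set I : {set 'I_(size S)} |
                             odd #|I| == b & k \in I]|)%N.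
    (* Inserting [k] flips the parity. *)
    apply: leq_trans (cardN (~~ b)) (card_setU1_family _) => B kB.
    by rewrite cardsU1 kB oddD; case: b; case: (odd #|B|).
  have [sumC0 onto cardG] := ssum_complement compl0 (cardN false) (cardY false).
  have [sumC1 _ _] := ssum_complement compl1 (cardN true) (cardY true).
  (* The even class contains the empty set, whose complement is thus even too: this is the parity of
     [size S]. Singletons are handled by the odd class. *)
  have [|evS sum0] := sumC0 set0; first by rewrite cards0.
  rewrite setC0 cardsT card_ord in evS.
  case: notel; have [|d cardGd elG] := @elem_abelian2_card G.
    move=> x; have [I <-] := onto x; apply: ssum_double0 => // i.
    by have [|_ ->] := sumC1 [set i]; rewrite ?cards1.
  exists d; split=> //; suff -> : d = (size S - 2)%N.
    by rewrite oddB // (eqP evS).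
  (* The even sets avoiding [k] number exactly [#|G|] and at least [2 ^ (size S - 2)], which gives
     the reverse of [leG]. *)
  apply/eqP; rewrite -(@eqn_exp2l 2) // -cardGd eqn_leq leG.
  by rewrite -cardG card_parity_avoiding.
split.
- rewrite -[log2 _]addr0 -[0]/(0%:R) log2_natE // muln1 => ltG.
  have [|I [J [_ _ neq eqIJ]]] := @pigeonhole _ _ (ssum S) setT.
    by rewrite -powersetT card_powerset cardsT card_ord.
  have [T [subT sizeT zsT]] := symdiff_pm_zero_sum eqIJ.
  exists T; split=> // T0; move: neq.
  by rewrite -symdiff_eq0 -cards_eq0 -sizeT T0.
rewrite -[1]/(1%:R) log2_natE // => ltG.
have size2 := expG 0 (ltnW ltG).
(* Only even index sets compete, so the symmetric difference is even; at least half of all index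
   sets still exceed [#|G|]. *)
have [|I [J [IE JE neq eqIJ]]] := @pigeonhole _ _ (ssum S)
    [set I in powerset setT | odd #|I| == false].
  apply: leq_trans (card_parity_powerset _ _); last first.
    by rewrite -card_gt0 cardsT card_ord ltnW.
  rewrite cardsT card_ord -(ltn_pmul2r (ltn0Sn 1)).
  by rewrite -expnSr (ltn_predK size2).
have [T [subT sizeT zsT]] := symdiff_pm_zero_sum eqIJ.
move: IE JE; rewrite !inE => /andP[_ /eqP pI] /andP[_ /eqP pJ].
exists T; split=> // [T0|]; last by rewrite sizeT odd_symdiff pI pJ.
by move: neq; rewrite -symdiff_eq0 -cards_eq0 -sizeT T0.
Qed.
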